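(* Let $p\ge 1$ be an integer, let $G\in C^1(\mathbb{D})$ be a complex-valued function (not necessarily harmonic), let $K:\mathbb{D}\to\mathbb{C}$ be harmonic, and let $f(z)=|z|^{2(p-1)}G(z)+K(z)$ for $z\in\mathbb{D}$. Suppose that $f$ is univalent and that $f(\mathbb{D})$ is a linearly connected domain with constant $M$. For $a\in\mathbb{C}$ put $f_a(z)=a|z|^{2(p-1)}G(z)+K(z)$. If $$\frac{2(p-1)|G|+\Lambda_G}{|\lambda_f|}<\frac1{2M}\quad\text{on }\mathbb{D},$$ then $f_a$ is univalent on $\mathbb{D}$ for every $a$ with $|a|<1$. Moreover, if there is a constant $C$ such that $$\frac{2(p-1)|G|+\Lambda_G}{|\lambda_f|}\le C<\frac1{2M}\quad\text{on }\mathbb{D},$$ then $f_a(\mathbb{D})$ is a linearly connected domain for every $a$ with $|a|<1$.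
   Context: $\mathbb{D}=\{z\in\mathbb{C}:|z|<1\}$. A complex-valued function is in $C^1(\mathbb{D})$ if its real and imaginary parts have continuous first-order partial derivatives in $\mathbb{D}$. A complex-valued function is harmonic if it is twice continuously differentiable and annihilated by the Laplacian $\Delta=4\frac{\partial^2}{\partial z\,\partial\overline z}$. Univalent means injective. For a $C^1$ function $g$, with Wirtinger derivatives $g_z,g_{\overline z}$, set $\lambda_g=|g_z|-|g_{\overline z}|$ and $\Lambda_g=|g_z|+|g_{\overline z}|$. A domain $\Omega\subset\mathbb{C}$ is linearly connected (with constant $M$) if $M<\infty$ is such that any two points $w_1,w_2\in\Omega$ are joined by a path $\gamma\subset\Omega$ of length $\ell(\gamma)\le M|w_1-w_2|$; it is linearly connected if this holds for some $M<\infty$. Inequalities between functions are understood to hold at every point of $\mathbb{D}$, with the quotients well defined (in particular $\lambda_f\ne0$ everywhere). *)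

(* Defs.v *)
From Stdlib Require Import Reals.
From Coquelicot Require Import Coquelicot.

Open Scope R_scope.

Definition unit_disk (z : C) : Prop := Cmod z < 1.

(* Functions on a set U are represented by total functions C -> C; every
   predicate below that is relative to an open set U depends only on the values
   on U.  The partial derivatives are total operators, meaningful only together
   with [ex_partials]. *)
Definition partial_x (g : C -> C) (z : C) : C :=
  (Derive (fun t => Re (g (t, Im z))) (Re z),
   Derive (fun t => Im (g (t, Im z))) (Re z)).

Definition partial_y (g : C -> C) (z : C) : C :=
  (Derive (fun t => Re (g (Re z, t))) (Im z),
   Derive (fun t => Im (g (Re z, t))) (Im z)).

Definition ex_partials (g : C -> C) (z : C) : Prop :=
  ex_derive (fun t => Re (g (t, Im z))) (Re z) /\
  ex_derive (fun t => Im (g (t, Im z))) (Re z) /\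
  ex_derive (fun t => Re (g (Re z, t))) (Im z) /\
  ex_derive (fun t => Im (g (Re z, t))) (Im z).

Definition C1_on (U : C -> Prop) (g : C -> C) : Prop :=
  (forall z, U z -> ex_partials g z) /\
  continuous_on U (partial_x g) /\
  continuous_on U (partial_y g).

Definition C2_on (U : C -> Prop) (g : C -> C) : Prop :=
  C1_on U g /\ C1_on U (partial_x g) /\ C1_on U (partial_y g).

Definition Dz (g : C -> C) (z : C) : C :=
  ((partial_x g z - Ci * partial_y g z) / RtoC 2)%C.

Definition Dzbar (g : C -> C) (z : C) : C :=
  ((partial_x g z + Ci * partial_y g z) / RtoC 2)%C.

Definition laplacian (g : C -> C) (z : C) : C :=
  (RtoC 4 * Dz (Dzbar g) z)%C.

Definition harmonic_on (U : C -> Prop) (g : C -> C) : Prop :=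
  C2_on U g /\ forall z, U z -> laplacian g z = RtoC 0.

Definition lambda (g : C -> C) (z : C) : R := Cmod (Dz g z) - Cmod (Dzbar g z).

Definition Lambda (g : C -> C) (z : C) : R := Cmod (Dz g z) + Cmod (Dzbar g z).

Definition univalent_on (U : C -> Prop) (g : C -> C) : Prop :=
  forall z1 z2, U z1 -> U z2 -> g z1 = g z2 -> z1 = z2.

Definition image (g : C -> C) (U : C -> Prop) (w : C) : Prop :=
  exists z, U z /\ g z = w.

Definition connected_set (A : C -> Prop) : Prop :=
  forall U V : C -> Prop,
    open U -> open V ->
    (forall z, A z -> U z \/ V z) ->
    (exists z, A z /\ U z) -> (exists z, A z /\ V z) ->
    exists z, A z /\ U z /\ V z.

Definition is_domain (A : C -> Prop) : Prop :=
  (exists z, A z) /\ open A /\ connected_set A.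

Definition unit_interval (t : R) : Prop := 0 <= t <= 1.

(* The subdivision is 0 = s 0 <= s 1 <= ... <= s (n+1) = 1. *)
Definition inscribed_length (gamma : R -> C) (l : R) : Prop :=
  exists (n : nat) (s : nat -> R),
    s O = 0 /\ s (S n) = 1 /\
    (forall i : nat, (i <= n)%nat -> s i <= s (S i)) /\
    l = sum_n (fun i => Cmod (gamma (s (S i)) - gamma (s i))%C) n.

Definition path_length (gamma : R -> C) : Rbar :=
  Lub_Rbar (inscribed_length gamma).

Definition path_in (A : C -> Prop) (w1 w2 : C) (gamma : R -> C) : Prop :=
  continuous_on unit_interval gamma /\
  (forall t, unit_interval t -> A (gamma t)) /\
  gamma 0 = w1 /\ gamma 1 = w2.

Definition linearly_connected_with (M : R) (A : C -> Prop) : Prop :=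
  forall w1 w2, A w1 -> A w2 ->
    exists gamma : R -> C,
      path_in A w1 w2 gamma /\
      Rbar_le (path_length gamma) (Finite (M * Cmod (w1 - w2)%C)).

Definition linearly_connected (A : C -> Prop) : Prop :=
  exists M : R, linearly_connected_with M A.

Definition f_family (p : nat) (G K : C -> C) (a z : C) : C :=
  (a * RtoC (Cmod z ^ (2 * (p - 1)))%R * G z + K z)%C.

(* Main.v *)
Require Import Defs.
From Stdlib Require Import Arith Reals Lra Lia Classical ClassicalEpsilon.
From Coquelicot Require Import Coquelicot.

(* Put H z = |z|^(2(p-1)) G z, so that f_a = f + (a - 1) H with |a - 1| < 2.  The
   hypothesis says that h = H o f^-1 has a differential of norm at most 1/(2M) on
   the image Omega of f.  Integrating along a path of length at most M |w1 - w2|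
   in Omega gives |h w1 - h w2| <= |w1 - w2| / 2, so the map w + (a - 1) h w,
   which carries Omega onto the image of f_a, is bi-Lipschitz and carries paths of
   controlled length to paths of controlled length.
   Integration is replaced by a supremum argument using only the pointwise
   Lipschitz constant of h, which needs the continuity of f^-1; this, like the
   openness of the image of f_a, comes from the nonvanishing Jacobian. *)

(** * Neighbourhoods in the plane and estimates for the modulus *)

Lemma sqrt_2_le_2 : sqrt 2 <= 2.
Proof. rewrite <- (sqrt_square 2) at 2 by lra; apply sqrt_le_1; lra. Qed.

(** Balls of the uniform structure on [C] are squares; on one of radius [d / 2] the modulus stays
    below [sqrt 2 * (d / 2)], hence below [d]. *)
Lemma locally_Cmod (z0 : C) (P : C -> Prop) :
  locally z0 P <->
  exists d : R, 0 < d /\ forall z, Cmod (z - z0) < d -> P z.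
Proof.
split.
- intros [d Hd]; exists (pos d); split; [apply cond_pos|].
  intros z Hz; apply Hd; exact (C_NormedModule_mixin_compat1 z0 z d Hz).
- intros [d [Hd H]].
  assert (Hd2 : 0 < d / 2) by lra.
  exists (mkposreal _ Hd2); intros z Hz; apply H.
  assert (H1 := C_NormedModule_mixin_compat2 z0 z (mkposreal _ Hd2) Hz).
  apply Rlt_le_trans with (1 := H1); simpl.
  assert (H2 := sqrt_2_le_2).
  nra.
Qed.

Lemma Cmod_le_2Rmax (z : C) : Cmod z <= 2 * Rmax (Rabs (Re z)) (Rabs (Im z)).
Proof.
apply Rle_trans with (1 := Cmod_2Rmax z).
assert (H2 := sqrt_2_le_2).
apply Rmult_le_compat_r; trivial.
apply Rle_trans with (2 := Rmax_l _ _); apply Rabs_pos.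
Qed.

Lemma Cmod_minus_triangle (x y : C) : Cmod (x - y) <= Cmod x + Cmod y.
Proof. rewrite <- (Cmod_opp y); apply Cmod_triangle. Qed.

Lemma Cmod_triangle_rev (x y : C) : Cmod x - Cmod y <= Cmod (x + y).
Proof.
assert (H := Cmod_minus_triangle (x + y) y).
replace (x + y - y)%C with x in H by ring; lra.
Qed.

Lemma Cmod_minus_sym (x y : C) : Cmod (x - y) = Cmod (y - x).
Proof. rewrite <- Cmod_opp; f_equal; ring. Qed.

Lemma im_le_Cmod (c : C) : Rabs (Im c) <= Cmod c.
Proof. apply Rle_trans with (2 := Rmax_Cmod c); apply Rmax_r. Qed.

(** * Real differentiability and Wirtinger derivatives *)

(** Fréchet differentiability over the reals: every real-linear map of the plane is
    [A * h + B * Cconj h], and [A], [B] are then the Wirtinger derivatives. Its operator norm is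
    [|A| + |B|], its least stretch [||A| - |B||], its Jacobian [|A|^2 - |B|^2]. *)
Definition real_diff (g : C -> C) (z0 A B : C) : Prop :=
  forall eps : R, 0 < eps -> exists d : R, 0 < d /\
    forall z, Cmod (z - z0) < d ->
      Cmod (g z - g z0 - (A * (z - z0) + B * Cconj (z - z0)))
        <= eps * Cmod (z - z0).

Lemma real_diff_ext_loc (g1 g2 : C -> C) (z0 A B : C) :
  locally z0 (fun z => g1 z = g2 z) ->
  real_diff g1 z0 A B -> real_diff g2 z0 A B.
Proof.
intros He H eps Heps; apply locally_Cmod in He.
destruct He as [d1 [Hd1 He]]; destruct (H eps Heps) as [d2 [Hd2 H2]].
exists (Rmin d1 d2); split; [apply Rmin_pos; trivial|].
intros z Hz.
rewrite <- (He z) by (apply Rlt_le_trans with (1 := Hz); apply Rmin_l).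
rewrite <- (He z0).
- apply H2; apply Rlt_le_trans with (1 := Hz); apply Rmin_r.
- replace (z0 - z0)%C with (RtoC 0) by ring; rewrite Cmod_0; lra.
Qed.

Lemma real_diff_lipschitz (g : C -> C) (z0 A B : C) (eps : R) :
  0 < eps -> real_diff g z0 A B -> exists d : R, 0 < d /\
    forall z, Cmod (z - z0) < d ->
      Cmod (g z - g z0) <= (Cmod A + Cmod B + eps) * Cmod (z - z0).
Proof.
intros Heps H; destruct (H eps Heps) as [d [Hd H1]]; exists d; split; trivial.
intros z Hz; specialize (H1 z Hz).
replace (g z - g z0)%C with ((g z - g z0 - (A * (z - z0) + B * Cconj (z - z0)))
  + (A * (z - z0) + B * Cconj (z - z0)))%C by ring.
apply Rle_trans with (1 := Cmod_triangle _ _).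
assert (H2 := Cmod_triangle (A * (z - z0)) (B * Cconj (z - z0))).
rewrite !Cmod_mult, Cmod_conj in H2; lra.
Qed.

Lemma real_diff_expansive (g : C -> C) (z0 A B : C) (eps : R) :
  0 < eps -> real_diff g z0 A B -> exists d : R, 0 < d /\
    forall z, Cmod (z - z0) < d ->
      (Rabs (Cmod A - Cmod B) - eps) * Cmod (z - z0) <= Cmod (g z - g z0).
Proof.
intros Heps H; destruct (H eps Heps) as [d [Hd H1]]; exists d; split; trivial.
intros z Hz; specialize (H1 z Hz).
assert (H2 := Cmod_minus_triangle (g z - g z0)
  (g z - g z0 - (A * (z - z0) + B * Cconj (z - z0)))).
replace (g z - g z0 - (g z - g z0 - (A * (z - z0) + B * Cconj (z - z0))))%C
  with (A * (z - z0) + B * Cconj (z - z0))%C in H2 by ring.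
(* Either of [|A|] and [|B|] may be the larger, so the reverse triangle inequality is taken both
   ways round. *)
assert (H3 := Cmod_triangle_rev (A * (z - z0)) (B * Cconj (z - z0))).
assert (H4 := Cmod_triangle_rev (B * Cconj (z - z0)) (A * (z - z0))).
rewrite (Cplus_comm (B * _)) in H4.
rewrite !Cmod_mult, Cmod_conj in H3, H4.
unfold Rabs; destruct Rcase_abs; lra.
Qed.

Lemma real_diff_continuous (g : C -> C) (z0 A B : C) :
  real_diff g z0 A B -> forall eps, 0 < eps -> exists d : R, 0 < d /\
    forall z, Cmod (z - z0) < d -> Cmod (g z - g z0) < eps.
Proof.
intros H eps Heps.
destruct (real_diff_lipschitz g z0 A B 1 Rlt_0_1 H) as [d [Hd H1]].
set (k := Cmod A + Cmod B + 1) in *.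
assert (Hk : 0 < k) by (unfold k; generalize (Cmod_ge_0 A) (Cmod_ge_0 B); lra).
exists (Rmin d (eps / k)); split.
- apply Rmin_pos; trivial; apply Rdiv_lt_0_compat; trivial.
- intros z Hz.
  apply Rle_lt_trans with (k * Cmod (z - z0)).
  + apply H1; apply Rlt_le_trans with (1 := Hz); apply Rmin_l.
  + replace eps with (k * (eps / k)) by (field; lra).
    apply Rmult_lt_compat_l; trivial.
    apply Rlt_le_trans with (1 := Hz); apply Rmin_r.
Qed.

Lemma real_diff_plus (g1 g2 : C -> C) (z0 A1 B1 A2 B2 : C) :
  real_diff g1 z0 A1 B1 -> real_diff g2 z0 A2 B2 ->
  real_diff (fun z => g1 z + g2 z)%C z0 (A1 + A2) (B1 + B2).
Proof.
intros H1 H2 eps Heps.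
assert (He : 0 < eps / 2) by lra.
destruct (H1 _ He) as [d1 [Hd1 K1]]; destruct (H2 _ He) as [d2 [Hd2 K2]].
exists (Rmin d1 d2); split; [apply Rmin_pos; trivial|].
intros z Hz.
assert (L1 := K1 z (Rlt_le_trans _ _ _ Hz (Rmin_l _ _))).
assert (L2 := K2 z (Rlt_le_trans _ _ _ Hz (Rmin_r _ _))).
replace (g1 z + g2 z - (g1 z0 + g2 z0) -
  ((A1 + A2) * (z - z0) + (B1 + B2) * Cconj (z - z0)))%C with
  ((g1 z - g1 z0 - (A1 * (z - z0) + B1 * Cconj (z - z0))) +
   (g2 z - g2 z0 - (A2 * (z - z0) + B2 * Cconj (z - z0))))%C by ring.
apply Rle_trans with (1 := Cmod_triangle _ _); lra.
Qed.

Lemma real_diff_mult (g1 g2 : C -> C) (z0 A1 B1 A2 B2 : C) :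
  real_diff g1 z0 A1 B1 -> real_diff g2 z0 A2 B2 ->
  real_diff (fun z => g1 z * g2 z)%C z0
    (A1 * g2 z0 + g1 z0 * A2) (B1 * g2 z0 + g1 z0 * B2).
Proof.
intros H1 H2 eps Heps.
set (k := Cmod A2 + Cmod B2 + 1).
(* [n] adds up the factors that multiply [eps / n]: one for each of the two remainders, and [k], a
   local Lipschitz constant of [g2], for the product of the increments. *)
set (n := Cmod (g1 z0) + Cmod (g2 z0) + k).
assert (Hk : 0 < k) by (unfold k; generalize (Cmod_ge_0 A2) (Cmod_ge_0 B2); lra).
assert (Hn : 0 < n)
  by (unfold n; generalize (Cmod_ge_0 (g1 z0)) (Cmod_ge_0 (g2 z0)); lra).
assert (He : 0 < eps / n) by (apply Rdiv_lt_0_compat; trivial).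
destruct (H1 _ He) as [d1 [Hd1 K1]]; destruct (H2 _ He) as [d2 [Hd2 K2]].
destruct (real_diff_lipschitz _ _ _ _ 1 Rlt_0_1 H2) as [d3 [Hd3 K3]].
destruct (real_diff_continuous _ _ _ _ H1 _ He) as [d4 [Hd4 K4]].
exists (Rmin (Rmin d1 d2) (Rmin d3 d4)); split; [repeat apply Rmin_pos; trivial|].
intros z Hz.
assert (Hz' := Rlt_le_trans _ _ _ Hz (Rmin_l _ _)).
assert (Hz'' := Rlt_le_trans _ _ _ Hz (Rmin_r _ _)).
assert (L1 := K1 z (Rlt_le_trans _ _ _ Hz' (Rmin_l _ _))).
assert (L2 := K2 z (Rlt_le_trans _ _ _ Hz' (Rmin_r _ _))).
assert (L3 := K3 z (Rlt_le_trans _ _ _ Hz'' (Rmin_l _ _))).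
assert (L4 := K4 z (Rlt_le_trans _ _ _ Hz'' (Rmin_r _ _))).
fold k in L3.
set (r1 := (g1 z - g1 z0 - (A1 * (z - z0) + B1 * Cconj (z - z0)))%C) in *.
set (r2 := (g2 z - g2 z0 - (A2 * (z - z0) + B2 * Cconj (z - z0)))%C) in *.
match goal with |- Cmod ?X <= _ => replace X with
  (r1 * g2 z0 + g1 z0 * r2 + (g1 z - g1 z0) * (g2 z - g2 z0))%C
  by (unfold r1, r2; ring) end.
apply Rle_trans with (1 := Cmod_triangle _ _).
assert (T := Cmod_triangle (r1 * g2 z0) (g1 z0 * r2)).
rewrite !Cmod_mult in *.
assert (P1 := Rmult_le_compat_r _ _ _ (Cmod_ge_0 (g2 z0)) L1).
assert (P2 := Rmult_le_compat_l _ _ _ (Cmod_ge_0 (g1 z0)) L2).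
assert (P3 := Rmult_le_compat _ _ _ _ (Cmod_ge_0 (g1 z - g1 z0))
  (Cmod_ge_0 (g2 z - g2 z0)) (Rlt_le _ _ L4) L3).
replace eps with (eps / n * n) by (field; lra).
unfold n at 2.
lra.
Qed.

Lemma real_diff_const (c z0 : C) : real_diff (fun _ => c) z0 0 0.
Proof.
intros eps Heps; exists 1; split; [lra|]; intros z _.
replace (c - c - (0 * (z - z0) + 0 * Cconj (z - z0)))%C with (RtoC 0) by ring.
rewrite Cmod_0; generalize (Cmod_ge_0 (z - z0)); nra.
Qed.

Lemma real_diff_id (z0 : C) : real_diff (fun z => z) z0 1 0.
Proof.
intros eps Heps; exists 1; split; [lra|]; intros z _.
replace (z - z0 - (1 * (z - z0) + 0 * Cconj (z - z0)))%C with (RtoC 0) by ring.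
rewrite Cmod_0; generalize (Cmod_ge_0 (z - z0)); nra.
Qed.

Lemma real_diff_conj (z0 : C) : real_diff Cconj z0 0 1.
Proof.
intros eps Heps; exists 1; split; [lra|]; intros z _.
rewrite Cminus_conj.
match goal with |- Cmod ?X <= _ => replace X with (RtoC 0) by ring end.
rewrite Cmod_0; generalize (Cmod_ge_0 (z - z0)); nra.
Qed.

Lemma real_diff_scal (c : C) (g : C -> C) (z0 A B : C) :
  real_diff g z0 A B ->
  real_diff (fun z => c * g z)%C z0 (c * A) (c * B).
Proof.
intros H.
assert (H1 := real_diff_mult _ _ _ _ _ _ _ (real_diff_const c z0) H).
replace (c * A)%C with (0 * g z0 + c * A)%C by ring.
replace (c * B)%C with (0 * g z0 + c * B)%C by ring.
exact H1.
Qed.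

Lemma Cmod_RtoC_pow_le_1 (n : nat) (z : C) :
  Cmod z <= 1 -> Cmod (RtoC (Cmod z ^ n)) <= 1.
Proof.
intros Hz; rewrite Cmod_R, Rabs_right by (apply Rle_ge, pow_le, Cmod_ge_0).
rewrite <- (pow1 n); apply pow_incr; split; trivial; apply Cmod_ge_0.
Qed.

(** Induction through [|z|^(2m+2) = |z|^(2m) * z * Cconj z], which is smooth also at the origin.
    Each new factor adds at most 1 to either derivative because [|z0| <= 1]. *)
Lemma real_diff_Cmod_pow (m : nat) (z0 : C) :
  Cmod z0 <= 1 -> exists A B : C, Cmod A <= INR m /\ Cmod B <= INR m /\
    real_diff (fun z => RtoC (Cmod z ^ (2 * m))) z0 A B.
Proof.
intros Hz0; induction m as [|m [A [B [HA [HB H]]]]].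
- exists (RtoC 0), (RtoC 0); rewrite Cmod_0; simpl.
  repeat split; try lra; apply real_diff_const.
- assert (HN := Cmod_RtoC_pow_le_1 (2 * m) _ Hz0).
  assert (K := real_diff_mult _ _ _ _ _ _ _ H
    (real_diff_mult _ _ _ _ _ _ _ (real_diff_id z0) (real_diff_conj z0))).
  match type of K with real_diff _ _ ?X ?Y => exists X, Y end.
  (* One estimate serves both derivatives: [c] is [Cconj z0] for the first and [z0] for the
     second. *)
  assert (E : forall X N c d : C, Cmod X <= INR m -> Cmod N <= 1 ->
    Cmod c <= 1 -> Cmod d <= 1 ->
    Cmod (X * (c * d) + N * c) <= INR (S m)).
  { intros X N c d HX HN' Hc Hd.
    apply Rle_trans with (1 := Cmod_triangle _ _); rewrite !Cmod_mult, S_INR.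
    generalize (Cmod_ge_0 X) (Cmod_ge_0 N) (Cmod_ge_0 c) (Cmod_ge_0 d); intros.
    assert (Cmod c * Cmod d <= 1) by nra.
    assert (0 <= Cmod c * Cmod d) by nra.
    nra. }
  split; [|split].
  + replace (1 * Cconj z0 + z0 * 0)%C with (Cconj z0) by ring.
    rewrite (Cmult_comm z0 (Cconj z0)).
    apply E; trivial; rewrite Cmod_conj; trivial.
  + replace (0 * Cconj z0 + z0 * 1)%C with z0 by ring.
    apply E; trivial; rewrite Cmod_conj; trivial.
  + apply real_diff_ext_loc with (2 := K).
    apply filter_forall; intros z.
    replace (2 * S m)%nat with (2 * m + 2)%nat by lia.
    rewrite pow_add, RtoC_mult; f_equal.
    now rewrite Cmod2_conj.
Qed.

(** The derivative in x is [A + B] and the one in y is [Ci * (A - B)], with real part [- Im (A - B)]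
    and imaginary part [Re (A - B)]. The factor 2 between the modulus and the maximum norm is
    absorbed by using [eps / 2]. *)
Lemma real_diff_components (g : C -> C) (z0 A B : C) :
  real_diff g z0 A B <->
  differentiable_pt_lim (fun x y => Re (g (x, y))) (Re z0) (Im z0)
    (Re (A + B)) (- Im (A - B)) /\
  differentiable_pt_lim (fun x y => Im (g (x, y))) (Re z0) (Im z0)
    (Im (A + B)) (Re (A - B)).
Proof.
assert (E : forall x y : R,
  let w := (g (x, y) - g z0
    - (A * ((x, y) - z0) + B * Cconj ((x, y) - z0)))%C in
  Re w = Re (g (x, y)) - Re (g z0) -
    (Re (A + B) * (x - Re z0) + - Im (A - B) * (y - Im z0)) /\
  Im w = Im (g (x, y)) - Im (g z0) -
    (Im (A + B) * (x - Re z0) + Re (A - B) * (y - Im z0))).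
{ intros x y; destruct (g (x, y)), (g z0), A, B, z0; unfold Re, Im; simpl; split; ring. }
assert (Ez : (Re z0, Im z0) = z0) by (now destruct z0).
split.
- intros H.
  assert (K : forall eps : posreal, exists d : posreal, forall x y,
     Rabs (x - Re z0) < d -> Rabs (y - Im z0) < d ->
     Cmod (g (x, y) - g z0
       - (A * ((x, y) - z0) + B * Cconj ((x, y) - z0)))%C
     <= eps * Rmax (Rabs (x - Re z0)) (Rabs (y - Im z0))).
  { intros eps; assert (He : 0 < eps / 2) by (generalize (cond_pos eps); lra).
    destruct (H _ He) as [d [Hd H1]].
    assert (Hd2 : 0 < d / 2) by lra; exists (mkposreal _ Hd2); simpl.
    intros x y Hx Hy.
    assert (L := Cmod_le_2Rmax ((x, y) - z0)%C).
    change (Re ((x, y) - z0)%C) with (x - Re z0) in L.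
    change (Im ((x, y) - z0)%C) with (y - Im z0) in L.
    assert (M := Rmax_lub_lt _ _ _ Hx Hy).
    apply Rle_trans with (1 := H1 (x, y) ltac:(lra)).
    nra. }
  split; intros eps; destruct (K eps) as [d Hd]; exists d; intros x y Hx Hy;
    specialize (Hd x y Hx Hy); rewrite Ez; destruct (E x y) as [E1 E2].
  + rewrite <- E1; apply Rle_trans with (2 := Hd); apply re_le_Cmod.
  + rewrite <- E2; apply Rle_trans with (2 := Hd); apply im_le_Cmod.
- intros [H1 H2] eps Heps; assert (He : 0 < eps / 2) by lra.
  destruct (H1 (mkposreal _ He)) as [d1 K1].
  destruct (H2 (mkposreal _ He)) as [d2 K2].
  exists (Rmin d1 d2); split; [apply Rmin_pos; apply cond_pos|].
  intros [x y] Hz.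
  destruct (E x y) as [E1 E2].
  apply Rle_trans with (1 := Cmod_le_2Rmax _).
  rewrite E1, E2.
  assert (Hm := Rmax_Cmod ((x, y) - z0)%C).
  change (fst ((x, y) - z0)%C) with (x - Re z0) in Hm.
  change (snd ((x, y) - z0)%C) with (y - Im z0) in Hm.
  assert (L1 := Rmax_l (Rabs (x - Re z0)) (Rabs (y - Im z0))).
  assert (L2 := Rmax_r (Rabs (x - Re z0)) (Rabs (y - Im z0))).
  assert (L3 := Rmin_l d1 d2).
  assert (L4 := Rmin_r d1 d2).
  specialize (K1 x y ltac:(lra) ltac:(lra)).
  specialize (K2 x y ltac:(lra) ltac:(lra)).
  rewrite Ez in K1, K2.
  assert (K := Rmax_lub _ _ _ K1 K2).
  apply Rle_trans with (1 := Rmult_le_compat_l _ _ _ (Rlt_le _ _ Rlt_0_2) K).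
  simpl pos.
  replace (2 * (eps / 2 * Rmax (Rabs (x - Re z0)) (Rabs (y - Im z0)))) with
    (eps * Rmax (Rabs (x - Re z0)) (Rabs (y - Im z0))) by field.
  apply Rmult_le_compat_l; lra.
Qed.

(** Uniqueness of the differential; it identifies [Dz f] and [Dzbar f] with the coefficients that
    the sum and product rules produce. *)
Lemma real_diff_Wirtinger (g : C -> C) (z0 A B : C) :
  real_diff g z0 A B -> Dz g z0 = A /\ Dzbar g z0 = B.
Proof.
intros H; apply real_diff_components in H; destruct H as [H1 H2].
apply differentiable_pt_lim_unique in H1; apply differentiable_pt_lim_unique in H2.
destruct H1 as [H1 H1']; destruct H2 as [H2 H2'].
unfold Dz, Dzbar, partial_x, partial_y.
simpl in H1, H1', H2, H2'.
rewrite H1, H1', H2, H2'.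
destruct A, B; unfold Re, Im; simpl.
split; apply injective_projections; simpl; field.
Qed.

(** The classical criterion, applied to the real and the imaginary part: an x-derivative that exists
    nearby and is continuous at the point, together with a y-derivative at the point, gives the
    differential. *)
Lemma C1_on_real_diff (U : C -> Prop) (g : C -> C) (z0 : C) :
  open U -> U z0 -> C1_on U g -> real_diff g z0 (Dz g z0) (Dzbar g z0).
Proof.
intros HU Hz0 [Hex [Hx Hy]].
assert (HUl : locally z0 U) by (apply HU; trivial).
(* [continuous_on] only gives a limit within [U]; openness of [U] makes it a full limit. *)
assert (Cx : continuous (partial_x g) z0).
{ intros P HP; specialize (Hx z0 Hz0 P HP).
  unfold filtermap, within in *.
  generalize (filter_and _ _ HUl Hx); apply filter_imp; intros z [A B]; auto. }
assert (Ez : (Re z0, Im z0) = z0) by (now destruct z0).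
destruct (Hex z0 Hz0) as [X1 [X2 [X3 X4]]].
apply real_diff_components.
replace (Re (Dz g z0 + Dzbar g z0)) with (fst (partial_x g z0))
  by (unfold Dz, Dzbar, Re; simpl; field).
replace (Im (Dz g z0 + Dzbar g z0)) with (snd (partial_x g z0))
  by (unfold Dz, Dzbar, Im; simpl; field).
replace (- Im (Dz g z0 - Dzbar g z0)) with (fst (partial_y g z0))
  by (unfold Dz, Dzbar, Im; simpl; field).
replace (Re (Dz g z0 - Dzbar g z0)) with (snd (partial_y g z0))
  by (unfold Dz, Dzbar, Re; simpl; field).
split; apply filterdiff_differentiable_pt_lim.
- apply (is_derive_filterdiff (fun x y => Re (g (x, y))) (Re z0) (Im z0)
    (fun x y => fst (partial_x g (x, y))) (fst (partial_y g z0))).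
  + rewrite Ez; apply filter_imp with (2 := HUl); intros z Hz.
    destruct (Hex z Hz) as [Y _].
    destruct z as [x y]; apply Derive_correct in Y; exact Y.
  + apply Derive_correct in X3; exact X3.
  + rewrite Ez.
    apply (continuous_ext (fun u : C => fst (partial_x g u))).
    { intros [x y]; reflexivity. }
    apply (continuous_comp (partial_x g) fst); [exact Cx|apply continuous_fst].
- apply (is_derive_filterdiff (fun x y => Im (g (x, y))) (Re z0) (Im z0)
    (fun x y => snd (partial_x g (x, y))) (snd (partial_y g z0))).
  + rewrite Ez; apply filter_imp with (2 := HUl); intros z Hz.
    destruct (Hex z Hz) as [_ [Y _]].
    destruct z as [x y]; apply Derive_correct in Y; exact Y.
  + apply Derive_correct in X4; exact X4.
  + rewrite Ez.
    apply (continuous_ext (fun u : C => snd (partial_x g u))).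
    { intros [x y]; reflexivity. }
    apply (continuous_comp (partial_x g) snd); [exact Cx|apply continuous_snd].
Qed.

(** * Local surjectivity *)

Definition in_square (z0 : C) (r : R) (z : C) : Prop :=
  Rabs (Re z - Re z0) <= r /\ Rabs (Im z - Im z0) <= r.

(** If the infimum [m] were not attained, [phi] would exceed [m] by a positive amount near each
    point, and by compactness by a uniform amount on the whole square. *)
Lemma square_min (phi : C -> R) (z0 : C) (r : R) :
  0 <= r -> (forall z, 0 <= phi z) ->
  (forall z, in_square z0 r z -> forall eps, 0 < eps -> exists d, 0 < d /\
    forall z', Cmod (z' - z) < d -> Rabs (phi z' - phi z) < eps) ->
  exists z, in_square z0 r z /\ forall z', in_square z0 r z' -> phi z <= phi z'.
Proof.
intros Hr Hpos Hc.
assert (Hz0 : in_square z0 r z0).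
{ split; replace (_ - _) with 0 by ring; rewrite Rabs_R0; trivial. }
(* [completeness] yields suprema, so the infimum of [phi] is taken as minus the supremum of
   [- phi]. *)
destruct (completeness (fun t => exists z, in_square z0 r z /\ t = - phi z))
  as [m' [Hub Hlub]].
{ exists 0; intros t [z [_ Ht]]; specialize (Hpos z); lra. }
{ exists (- phi z0), z0; auto. }
set (m := - m').
assert (Hm : forall z, in_square z0 r z -> m <= phi z).
{ intros z Hz; specialize (Hub (- phi z)); unfold m.
  assert (- phi z <= m') by (apply Hub; exists z; auto); lra. }
apply NNPP; intros Hno.
assert (Hlt : forall z, in_square z0 r z -> m < phi z).
{ intros z Hz; destruct (Hm z Hz) as [K|K]; trivial; exfalso; apply Hno.
  exists z; split; trivial; rewrite <- K; trivial. }
(* The gauge is also kept below half the gap [phi - m], so that the uniform lower bound on the gauge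
   becomes a lower bound for [phi - m]. *)
assert (Hd : forall u v : R, exists d : posreal, in_square z0 r (u, v) ->
  pos d <= (phi (u, v) - m) / 2 /\
  forall x y, Rabs (x - u) < d -> Rabs (y - v) < d ->
    Rabs (phi (x, y) - phi (u, v)) < (phi (u, v) - m) / 2).
{ intros u v; destruct (classic (in_square z0 r (u, v))) as [I|I].
  2: exists (mkposreal 1 Rlt_0_1); intros K; contradiction.
  specialize (Hlt _ I).
  assert (He : 0 < (phi (u, v) - m) / 2) by lra.
  destruct (Hc _ I _ He) as [d [Hd H]].
  assert (Hd2 : 0 < Rmin (d / 2) ((phi (u, v) - m) / 2)) by (apply Rmin_pos; lra).
  exists (mkposreal _ Hd2); intros _; simpl; split; [apply Rmin_r|].
  intros x y Hx Hy; apply H.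
  apply Rle_lt_trans with (1 := Cmod_le_2Rmax _).
  change (Re ((x, y) - (u, v))%C) with (x - u).
  change (Im ((x, y) - (u, v))%C) with (y - v).
  assert (M := Rmax_lub_lt _ _ _ Hx Hy).
  assert (L := Rmin_l (d / 2) ((phi (u, v) - m) / 2)); lra. }
set (delta := fun u v => proj1_sig (constructive_indefinite_description _ (Hd u v))).
assert (Hdelta : forall u v, in_square z0 r (u, v) ->
  pos (delta u v) <= (phi (u, v) - m) / 2 /\
  forall x y, Rabs (x - u) < delta u v -> Rabs (y - v) < delta u v ->
    Rabs (phi (x, y) - phi (u, v)) < (phi (u, v) - m) / 2).
{ intros u v; unfold delta.
  destruct (constructive_indefinite_description _ (Hd u v)); trivial. }
assert (Sq : forall x y, in_square z0 r (x, y) <->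
  Re z0 - r <= x <= Re z0 + r /\ Im z0 - r <= y <= Im z0 + r).
{ intros x y; unfold in_square.
  change (Re (x, y)) with x; change (Im (x, y)) with y.
  split; [intros [H1 H2]; apply Rabs_le_between in H1, H2; lra|].
  intros H; split; apply Rabs_le; lra. }
destruct (compactness_value_2d (Re z0 - r) (Re z0 + r) (Im z0 - r) (Im z0 + r) delta)
  as [d H].
assert (Hmd : m + d <= m); [|generalize (cond_pos d); lra].
assert (Hall : forall z, in_square z0 r z -> m + d <= phi z).
{ intros [x y] Hz; apply Sq in Hz as Hz'; destruct Hz' as [Hx Hy].
  (* The compactness statement is doubly negated, hence the argument by contradiction. *)
  apply Rnot_lt_le; intros Hlt'; apply (H x y Hx Hy).
  intros [u [v [Hu [Hv [Hxu [Hyv Hdd]]]]]].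
  destruct (Hdelta u v) as [D1 D2]; [apply Sq; auto|].
  specialize (D2 x y Hxu Hyv); apply Rabs_lt_between in D2; lra. }
assert (m' <= - (m + d)); [|unfold m in *; lra].
apply Hlub; intros t [z [Hz ->]]; specialize (Hall z Hz); lra.
Qed.

(** Cramer's rule for the equation and its conjugate; the determinant [D] is the Jacobian
    [|A|^2 - |B|^2]. *)
Lemma real_linear_surjective (A B v : C) :
  Cmod A <> Cmod B -> exists d : C, (A * d + B * Cconj d)%C = v.
Proof.
intros H.
set (D := (A * Cconj A - B * Cconj B)%C).
assert (HD : D <> 0).
{ unfold D; rewrite <- !Cmod2_conj, <- RtoC_minus; intros K; apply RtoC_inj in K.
  generalize (Cmod_ge_0 A) (Cmod_ge_0 B); intros; apply H; nra. }
assert (HDc : Cconj D = D).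
{ unfold D; rewrite Cminus_conj, !Cmult_conj, !Cconj_conj; ring. }
exists ((Cconj A * v - B * Cconj v) / D)%C.
rewrite Cdiv_conj, HDc by trivial.
rewrite Cminus_conj, !Cmult_conj, !Cconj_conj.
(* The fifth occurrence is the right-hand side; unfolding only the [D] of its numerator lets [field]
   treat the denominators as one atom. *)
replace v with (D * v / D)%C at 5 by (field; trivial).
unfold D at 3; field; trivial.
Qed.

(** The differential maps some [d] to [w - F z]. A step [t * d] scales the distance to [w] by
    [1 - t], up to a remainder of at most [t * |w - F z| / 2]. *)
Lemma real_diff_decrease (F : C -> C) (z A B w : C) (r : R) :
  Cmod A <> Cmod B -> real_diff F z A B -> F z <> w -> 0 < r ->
  exists z', Cmod (z' - z) < r /\ Cmod (F z' - w) < Cmod (F z - w).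
Proof.
intros HAB HF Hne Hr.
set (v := (w - F z)%C).
assert (Hv : 0 < Cmod v).
{ apply Cmod_gt_0; intros K; apply Hne.
  replace w with (F z + (w - F z))%C by ring; fold v; rewrite K; ring. }
destruct (real_linear_surjective A B v HAB) as [d Hd].
set (n := Cmod d + 1); assert (Hn : 0 < n) by (unfold n; generalize (Cmod_ge_0 d); lra).
destruct (HF (Cmod v / (2 * n))) as [e [He H]].
{ apply Rdiv_lt_0_compat; lra. }
(* The bounds on [t] keep [t * d] within both radii [e] and [r]; the 1 added in [n] keeps the
   divisor positive if [d] is 0. *)
set (t := Rmin 1 (Rmin (e / (2 * n)) (r / (2 * n)))).
assert (Ht : 0 < t)
  by (unfold t; repeat apply Rmin_pos; try apply Rdiv_lt_0_compat; lra).
assert (Ht1 : t <= 1) by apply Rmin_l.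
assert (Hb : forall x, 0 < x -> t <= x / (2 * n) -> Cmod (t * d) < x).
{ intros x Hx Hle; rewrite Cmod_mult, Cmod_R, Rabs_right by lra.
  apply Rle_lt_trans with (x / (2 * n) * n).
  - apply Rmult_le_compat; try lra; [apply Cmod_ge_0|unfold n; lra].
  - replace (x / (2 * n) * n) with (x / 2) by (field; lra); lra. }
assert (Hzd : (z + t * d - z = t * d)%C) by ring.
exists (z + t * d)%C; rewrite Hzd; split.
- apply Hb; trivial; unfold t; apply Rle_trans with (1 := Rmin_r _ _); apply Rmin_r.
- specialize (H (z + t * d)%C); rewrite Hzd in H.
  specialize (H (Hb e He ltac:(unfold t; apply Rle_trans with (1 := Rmin_r _ _); apply Rmin_l))).
  set (rr := (F (z + t * d) - F z - (A * (t * d) + B * Cconj (t * d)))%C) in *.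
  replace (F (z + t * d) - w)%C with (rr - RtoC (1 - t) * v)%C.
  2: { unfold rr; rewrite RtoC_minus.
       replace (Cconj (t * d)) with (t * Cconj d)%C.
       2: { rewrite Cmult_conj; f_equal; unfold Cconj, RtoC; simpl; f_equal; ring. }
       replace (A * (t * d) + B * (t * Cconj d))%C with (t * (A * d + B * Cconj d))%C by ring.
       rewrite Hd; unfold v; ring. }
  replace (Cmod (F z - w)) with (Cmod v) by (unfold v; apply Cmod_minus_sym).
  apply Rle_lt_trans with (1 := Cmod_minus_triangle _ _).
  rewrite Cmod_mult, Cmod_R, (Rabs_right (1 - t)) by lra.
  assert (Cmod rr <= t * Cmod v / 2); [|nra].
  apply Rle_trans with (1 := H).
  rewrite Cmod_mult, Cmod_R, Rabs_right by lra.
  replace (t * Cmod v / 2) with (Cmod v / (2 * n) * (t * n)) by (field; lra).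
  apply Rmult_le_compat_l.
  + apply Rlt_le, Rdiv_lt_0_compat; lra.
  + apply Rmult_le_compat_l; unfold n; lra.
Qed.

(* A minimizer of [Cmod (F z - w)] on a small closed square around [z0] cannot
   lie on the boundary, where [F z] is far from [F z0], and at an interior point
   invertibility of the differential allows to decrease a nonzero minimum. *)
Lemma real_diff_local_surjective (U : C -> Prop) (F : C -> C) (z0 : C) (r : R) :
  open U -> U z0 -> 0 < r ->
  (forall z, U z -> exists A B : C, Cmod A <> Cmod B /\ real_diff F z A B) ->
  exists d, 0 < d /\ forall w, Cmod (w - F z0) < d ->
    exists z, U z /\ Cmod (z - z0) < r /\ F z = w.
Proof.
intros HU Hz0 Hr HF.
destruct (proj1 (locally_Cmod z0 U) (HU z0 Hz0)) as [r1 [Hr1 HUr]].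
destruct (HF z0 Hz0) as [A [B [HAB H0]]].
set (l := Rabs (Cmod A - Cmod B)).
assert (Hl : 0 < l) by (apply Rabs_pos_lt; lra).
destruct (real_diff_expansive F z0 A B (l / 2) ltac:(lra) H0) as [r2 [Hr2 Hexp]].
fold l in Hexp; replace (l - l / 2) with (l / 2) in Hexp by field.
(* The modulus is at most twice the maximum norm, so a third of the least radius puts the closed
   square inside all three open disks. *)
set (rho := Rmin r (Rmin r1 r2) / 3).
assert (Hmin : 0 < Rmin r (Rmin r1 r2)) by (repeat apply Rmin_pos; trivial).
assert (Hrho : 0 < rho) by (unfold rho; lra).
assert (Hsq : forall z, in_square z0 rho z ->
  Cmod (z - z0) < r /\ Cmod (z - z0) < r1 /\ Cmod (z - z0) < r2).
{ intros z [Hx Hy].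
  assert (L := Cmod_le_2Rmax (z - z0)).
  change (Re (z - z0)%C) with (Re z - Re z0) in L.
  change (Im (z - z0)%C) with (Im z - Im z0) in L.
  assert (M := Rmax_lub _ _ _ Hx Hy).
  assert (L1 := Rmin_l r (Rmin r1 r2)); assert (L2 := Rmin_r r (Rmin r1 r2)).
  assert (L3 := Rmin_l r1 r2); assert (L4 := Rmin_r r1 r2).
  unfold rho in M; lra. }
(* If [|z - z0| >= rho], then [F z] is at least [l * rho / 2] away from [F z0], so it is farther
   from [w] than [F z0] and [z] is no minimizer. *)
exists (l * rho / 4); split; [assert (0 < l * rho) by (apply Rmult_lt_0_compat; trivial); lra|].
intros w Hw.
destruct (square_min (fun z => Cmod (F z - w)) z0 rho) as [z [Hz Hzmin]].
- lra.
- intros z; apply Cmod_ge_0.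
- intros z Hz eps Heps.
  destruct (HF z) as [A' [B' [_ H']]]; [apply HUr, Hsq; trivial|].
  destruct (real_diff_continuous _ _ _ _ H' eps Heps) as [d [Hd H]].
  exists d; split; trivial; intros z' Hz'; specialize (H z' Hz').
  assert (T1 := Cmod_triangle (F z' - F z) (F z - w)).
  assert (T2 := Cmod_triangle (F z - F z') (F z' - w)).
  replace (F z' - F z + (F z - w))%C with (F z' - w)%C in T1 by ring.
  replace (F z - F z' + (F z' - w))%C with (F z - w)%C in T2 by ring.
  rewrite (Cmod_minus_sym (F z) (F z')) in T2.
  cbv beta; apply Rabs_lt_between; lra.
- destruct (Hsq z Hz) as [Z1 [Z2 Z3]].
  exists z; split; [apply HUr; trivial|split; trivial].
  apply NNPP; intros Hne.
  assert (Hz0s : in_square z0 rho z0).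
  { split; replace (_ - _) with 0 by ring; rewrite Rabs_R0; lra. }
  assert (M0 := Hzmin z0 Hz0s).
  rewrite (Cmod_minus_sym (F z0)) in M0.
  assert (Hin : Cmod (z - z0) < rho).
  { apply Rnot_le_lt; intros K.
    assert (X := Hexp z Z3).
    assert (T := Cmod_triangle (F z - w) (w - F z0)).
    replace (F z - w + (w - F z0))%C with (F z - F z0)%C in T by ring.
    nra. }
  destruct (HF z (HUr z Z2)) as [A' [B' [HAB' H']]].
  destruct (real_diff_decrease F z A' B' w (rho - Cmod (z - z0)) HAB' H' Hne)
    as [z' [Hz' Hlt]]; [lra|].
  apply (Rlt_not_le _ _ Hlt), Hzmin.
  assert (T := Cmod_triangle (z' - z) (z - z0)).
  replace (z' - z + (z - z0))%C with (z' - z0)%C in T by ring.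
  split; apply Rle_trans with (Cmod (z' - z0)); try lra.
  + apply (re_le_Cmod (z' - z0)).
  + apply (im_le_Cmod (z' - z0)).
Qed.

Lemma real_diff_open_image (U : C -> Prop) (F : C -> C) :
  open U ->
  (forall z, U z -> exists A B : C, Cmod A <> Cmod B /\ real_diff F z A B) ->
  open (image F U).
Proof.
intros HU HF w [z0 [Hz0 <-]].
destruct (real_diff_local_surjective U F z0 1 HU Hz0 Rlt_0_1 HF) as [d [Hd H]].
apply locally_Cmod; exists d; split; trivial.
intros w Hw; destruct (H w Hw) as [z [Hz [_ Ez]]]; exists z; auto.
Qed.

(* The bound on the differential of [H o f^-1] at [f z0], where
   [A, B] and [A', B'] are the Wirtinger derivatives of [f] and [H]. *)
Lemma inverse_composition_lipschitz (U : C -> Prop) (f H : C -> C)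
  (z0 A B A' B' : C) (k eps : R) :
  open U -> U z0 -> univalent_on U f ->
  (forall z, U z -> exists A B : C, Cmod A <> Cmod B /\ real_diff f z A B) ->
  Cmod A <> Cmod B -> real_diff f z0 A B -> real_diff H z0 A' B' ->
  0 <= k -> Cmod A' + Cmod B' <= k * Rabs (Cmod A - Cmod B) -> 0 < eps ->
  exists d, 0 < d /\ forall z, U z -> Cmod (f z - f z0) < d ->
    Cmod (H z - H z0) <= (k + eps) * Cmod (f z - f z0).
Proof.
intros HU Hz0 Hinj Hf HAB Hf0 HH Hk Hle Heps.
set (l := Rabs (Cmod A - Cmod B)) in *.
assert (Hl : 0 < l) by (apply Rabs_pos_lt; lra).
(* The solution of [k * l + eta = (k + eps) * (l - eta)], which compares the growth of [H] with the
   stretch of [f]. *)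
set (eta := eps * l / (1 + k + eps)).
assert (Heta : 0 < eta) by (apply Rdiv_lt_0_compat; [apply Rmult_lt_0_compat; trivial|lra]).
assert (Ee : eta * (1 + k + eps) = eps * l) by (unfold eta; field; lra).
destruct (real_diff_expansive f z0 A B eta Heta Hf0) as [d1 [Hd1 H1]].
destruct (real_diff_lipschitz H z0 A' B' eta Heta HH) as [d2 [Hd2 H2]].
fold l in H1.
(* Continuity of the inverse of [f]: a value near [f z0] has a preimage near [z0], which by
   injectivity is [z]. *)
destruct (real_diff_local_surjective U f z0 (Rmin d1 d2) HU Hz0
  (Rmin_pos _ _ Hd1 Hd2) Hf) as [d [Hd H3]].
exists d; split; trivial; intros z Hz Hzd.
destruct (H3 (f z) Hzd) as [z' [Hz' [Hz'd Ez]]].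
rewrite <- (Hinj z' z Hz' Hz Ez).
specialize (H1 z' (Rlt_le_trans _ _ _ Hz'd (Rmin_l _ _))).
specialize (H2 z' (Rlt_le_trans _ _ _ Hz'd (Rmin_r _ _))).
apply Rle_trans with (1 := H2).
apply Rle_trans with ((k + eps) * ((l - eta) * Cmod (z' - z0))).
- rewrite <- Rmult_assoc; apply Rmult_le_compat_r; [apply Cmod_ge_0|nra].
- apply Rmult_le_compat_l; lra.
Qed.

(** * Paths and their lengths *)

(* [chain gamma s t l]: some subdivision of [s, t] gives an inscribed polygon of
   length [l]. *)
Inductive chain (gamma : R -> C) (s : R) : R -> R -> Prop :=
| chain_refl : chain gamma s s 0
| chain_step (t u l : R) : chain gamma s t l -> t <= u ->
    chain gamma s u (l + Cmod (gamma u - gamma t)).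

Lemma chain_trans (gamma : R -> C) (s t u l l' : R) :
  chain gamma s t l -> chain gamma t u l' -> chain gamma s u (l + l').
Proof.
intros H H'; induction H' as [|v w l' _ IH Hvw].
- rewrite Rplus_0_r; trivial.
- rewrite <- Rplus_assoc; apply chain_step; trivial.
Qed.

Lemma chain_subdivision (gamma : R -> C) (a t l : R) :
  chain gamma a t l -> exists (n : nat) (s : nat -> R),
    s O = a /\ s (S n) = t /\
    (forall i : nat, (i <= n)%nat -> s i <= s (S i)) /\
    l = sum_n (fun i => Cmod (gamma (s (S i)) - gamma (s i))%C) n.
Proof.
intros H; induction H as [|t u l _ [n [s [H0 [Ht [Hinc Hl]]]]] Htu].
(* A subdivision has at least one interval, so the empty chain becomes a degenerate one. *)
- exists O, (fun _ => a); repeat split; try (intros; lra).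
  rewrite sum_O; replace (gamma a - gamma a)%C with (RtoC 0) by ring.
  now rewrite Cmod_0.
- exists (S n), (fun i => if le_lt_dec i (S n) then s i else u).
  assert (E : forall i, (i <= S n)%nat ->
    (if le_lt_dec i (S n) then s i else u) = s i).
  { intros i Hi; destruct (le_lt_dec i (S n)); trivial; lia. }
  assert (Eu : (if le_lt_dec (S (S n)) (S n) then s (S (S n)) else u) = u).
  { destruct (le_lt_dec (S (S n)) (S n)); trivial; lia. }
  repeat split.
  + rewrite E by lia; trivial.
  + trivial.
  + intros i Hi; destruct (Nat.eq_dec i (S n)) as [->|Hne].
    * rewrite E, Eu, Ht by lia; trivial.
    * rewrite !E by lia; apply Hinc; lia.
  + rewrite sum_Sn, Eu, E, Ht, Hl by lia.
    apply (f_equal2 Rplus); trivial; apply sum_n_ext_loc; intros i Hi; rewrite !E by lia; trivial.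
Qed.

Lemma chain_path_length (gamma : R -> C) (l L : R) :
  chain gamma 0 1 l -> Rbar_le (path_length gamma) L -> l <= L.
Proof.
intros H HL.
destruct (Lub_Rbar_correct (inscribed_length gamma)) as [Hub _].
exact (Rbar_le_trans _ _ _ (Hub l (chain_subdivision gamma 0 1 l H)) HL).
Qed.

(* Supremum argument over the right endpoints reached by a good chain. *)
Lemma chain_local_lipschitz (gamma u : R -> C) (k a b : R) :
  a <= b ->
  (forall t, a <= t <= b -> exists d, 0 < d /\
    forall s, a <= s <= b -> Rabs (s - t) < d ->
      Cmod (u s - u t) <= k * Cmod (gamma s - gamma t)) ->
  exists l, chain gamma a b l /\ Cmod (u b - u a) <= k * l.
Proof.
intros Hab Hloc.
set (P := fun x => exists l, chain gamma a x l /\ Cmod (u x - u a) <= k * l).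
set (E := fun x => a <= x <= b /\ P x).
assert (Pa : P a).
{ exists 0; split; [apply chain_refl|].
  replace (u a - u a)%C with (RtoC 0) by ring; rewrite Cmod_0; lra. }
assert (Hstep : forall x y, x <= y -> P x ->
  Cmod (u y - u x) <= k * Cmod (gamma y - gamma x) -> P y).
{ intros x y Hxy [l [Hc Hl]] H.
  exists (l + Cmod (gamma y - gamma x)); split; [apply chain_step; trivial|].
  assert (T := Cmod_triangle (u y - u x) (u x - u a)).
  replace (u y - u x + (u x - u a))%C with (u y - u a)%C in T by ring.
  lra. }
destruct (completeness E) as [m [Hub Hlub]].
{ exists b; intros x [Hx _]; lra. }
{ exists a; split; trivial; lra. }
assert (Ham : a <= m) by (apply Hub; split; trivial; lra).
assert (Hmb : m <= b) by (apply Hlub; intros x [Hx _]; lra).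
destruct (Hloc m (conj Ham Hmb)) as [d [Hd H]].
assert (Hx : exists x, E x /\ m - d < x).
{ apply NNPP; intros K.
  assert (m <= m - d); [|lra].
  apply Hlub; intros x Hx; apply Rnot_lt_le; intros Hlt; apply K; exists x; auto. }
destruct Hx as [x [[Hx Px] Hxm]].
assert (Hxm' : x <= m) by (apply Hub; split; trivial).
(* The local estimate at the supremum [m] works on both sides: from a good [x] up to [m], then from
   [m] on to [y], which forces [m = b]. *)
assert (Pm : P m).
{ apply Hstep with x; trivial.
  rewrite (Cmod_minus_sym (u m)), (Cmod_minus_sym (gamma m)).
  apply H; trivial; rewrite Rabs_left1; lra. }
set (y := Rmin b (m + d / 2)).
assert (Hy1 : y <= b) by apply Rmin_l.
assert (Hy2 : y <= m + d / 2) by apply Rmin_r.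
assert (Hy3 : m <= y) by (apply Rmin_glb; lra).
assert (Py : P y).
{ apply Hstep with m; trivial; apply H; [lra|].
  rewrite Rabs_right; lra. }
assert (Hym : y <= m) by (apply Hub; split; trivial; lra).
replace b with y; [exact Py|].
unfold y, Rmin in *; destruct (Rle_dec b (m + d / 2)); lra.
Qed.

(** Each side of a polygon inscribed in [u] is at most [k] times the length of a chain of [gamma]
    over the same parameter interval, and these chains concatenate. *)
Lemma path_length_local_lipschitz (gamma u : R -> C) (k L : R) :
  0 <= k ->
  (forall t, unit_interval t -> exists d, 0 < d /\
    forall s, unit_interval s -> Rabs (s - t) < d ->
      Cmod (u s - u t) <= k * Cmod (gamma s - gamma t)) ->
  Rbar_le (path_length gamma) L -> Rbar_le (path_length u) (k * L).
Proof.
intros Hk Hloc HL.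
destruct (Lub_Rbar_correct (inscribed_length u)) as [_ Hlub].
apply Hlub; intros x [n [s [H0 [H1 [Hinc ->]]]]]; simpl.
assert (Hs : forall i j, (i <= j)%nat -> (j <= S n)%nat -> s i <= s j).
{ intros i j Hij; induction Hij as [|j Hij IH]; intros Hj; [lra|].
  apply Rle_trans with (s j); [apply IH; lia|apply Hinc; lia]. }
assert (Hu : forall i, (i <= S n)%nat -> unit_interval (s i)).
{ intros i Hi; split; [rewrite <- H0|rewrite <- H1]; apply Hs; lia. }
assert (Hseg : forall i, (i <= n)%nat -> exists l, chain gamma (s i) (s (S i)) l /\
  Cmod (u (s (S i)) - u (s i)) <= k * l).
{ intros i Hi; apply chain_local_lipschitz; [apply Hinc; lia|].
  assert (U1 := Hu i ltac:(lia)); assert (U2 := Hu (S i) ltac:(lia)).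
  unfold unit_interval in *.
  intros t Ht; destruct (Hloc t ltac:(lra)) as [d [Hd H]].
  exists d; split; trivial; intros x Hx; apply H; lra. }
assert (Hsum : forall i, (i <= n)%nat -> exists l, chain gamma 0 (s (S i)) l /\
  sum_n (fun j => Cmod (u (s (S j)) - u (s j))%C) i <= k * l).
{ induction i as [|i IH]; intros Hi.
  - rewrite sum_O, <- H0; apply Hseg; lia.
  - destruct IH as [l [Hl Hle]]; [lia|].
    destruct (Hseg (S i) Hi) as [l' [Hl' Hle']].
    exists (l + l'); split; [apply chain_trans with (s (S i)); trivial|].
    rewrite sum_Sn; unfold plus; simpl; lra. }
destruct (Hsum n (le_n n)) as [l [Hl Hle]].
rewrite H1 in Hl.
apply Rle_trans with (1 := Hle), Rmult_le_compat_l; trivial.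
apply chain_path_length with gamma; trivial.
Qed.

(** * Continuity of paths, connectedness and linear connectivity *)

Lemma path_continuous (gamma : R -> C) :
  continuous_on unit_interval gamma <->
  forall t, unit_interval t -> forall eps, 0 < eps -> exists d, 0 < d /\
    forall s, unit_interval s -> Rabs (s - t) < d ->
      Cmod (gamma s - gamma t) < eps.
Proof.
split.
- intros H t Ht eps Heps.
  destruct (H t Ht (fun w => Cmod (w - gamma t) < eps)) as [d Hd].
  { apply locally_Cmod; exists eps; auto. }
  exists d; split; [apply cond_pos|]; intros s Hs Hst; apply Hd; trivial.
- intros H t Ht P HP; apply locally_Cmod in HP; destruct HP as [e [He HP]].
  destruct (H t Ht e He) as [d [Hd H1]].
  exists (mkposreal d Hd); intros s Hst Hs; apply HP, H1; trivial.
Qed.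

(** Along a path from [U] to [V], let [m] be the supremum of the parameters mapped into [U]. If
    [gamma m] is in [U], then [m] is 1, whose point is in [V]; if it is in [V], parameters just
    before [m] are mapped into both sets. *)
Lemma path_connected_connected (A : C -> Prop) :
  (forall w1 w2, A w1 -> A w2 -> exists gamma, path_in A w1 w2 gamma) ->
  connected_set A.
Proof.
intros HA U V HU HV Hcov [w1 [A1 U1]] [w2 [A2 V2]].
destruct (HA w1 w2 A1 A2) as [gamma [Hc [Hin [G0 G1]]]].
assert (Hloc : forall W : C -> Prop, open W -> forall t, unit_interval t ->
  W (gamma t) -> exists d, 0 < d /\
  forall s, unit_interval s -> Rabs (s - t) < d -> W (gamma s)).
{ intros W HW t Ht Wt.
  destruct (proj1 (locally_Cmod (gamma t) W) (HW _ Wt)) as [e [He H]].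
  destruct (proj1 (path_continuous gamma) Hc t Ht e He) as [d [Hd H1]].
  exists d; split; auto. }
apply NNPP; intros Hno.
set (E := fun t => unit_interval t /\ U (gamma t)).
assert (E0 : E 0) by (split; [unfold unit_interval; lra|rewrite G0; trivial]).
destruct (completeness E) as [m [Hub Hlub]].
{ exists 1; intros t [[_ Ht] _]; trivial. }
{ exists 0; trivial. }
assert (Hm : unit_interval m).
{ split; [apply Hub; trivial|apply Hlub; intros t [[_ Ht] _]; trivial]. }
destruct (Hcov (gamma m) (Hin m Hm)) as [Um|Vm].
- destruct (Hloc U HU m Hm Um) as [d [Hd H]].
  set (y := Rmin 1 (m + d / 2)).
  assert (Hy1 : y <= 1) by apply Rmin_l.
  assert (Hy2 : y <= m + d / 2) by apply Rmin_r.
  destruct Hm as [Hm0 Hm1].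
  assert (Hy3 : m <= y) by (apply Rmin_glb; lra).
  assert (Iy : unit_interval y) by (unfold unit_interval; lra).
  assert (Uy : U (gamma y)) by (apply H; trivial; rewrite Rabs_right; lra).
  assert (Hym : y <= m) by (apply Hub; split; trivial).
  assert (E1 : y = 1) by (unfold y, Rmin in *; destruct (Rle_dec 1 (m + d / 2)); lra).
  apply Hno; exists (gamma y); split; [auto|split; trivial].
  rewrite E1, G1; trivial.
- destruct (Hloc V HV m Hm Vm) as [d [Hd H]].
  assert (m <= m - d); [|lra].
  apply Hlub; intros t [It Ut]; apply Rnot_lt_le; intros Hlt.
  assert (Htm : t <= m) by (apply Hub; split; trivial).
  apply Hno; exists (gamma t); split; [auto|split; trivial].
  apply H; trivial; rewrite Rabs_left1; lra.
Qed.

Lemma open_not_singleton (A : C -> Prop) (w : C) :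
  open A -> A w -> exists w', A w' /\ w' <> w.
Proof.
intros HA Hw; destruct (proj1 (locally_Cmod w A) (HA w Hw)) as [d [Hd H]].
exists (w + RtoC (d / 2))%C; split.
- apply H; replace (w + RtoC (d / 2) - w)%C with (RtoC (d / 2)) by ring.
  rewrite Cmod_R, Rabs_right; lra.
- intros E; assert (K : RtoC (d / 2) = RtoC 0).
  { replace (RtoC (d / 2)) with (w + RtoC (d / 2) - w)%C by ring; rewrite E; ring. }
  apply RtoC_inj in K; lra.
Qed.

(** A path is at least as long as its chord, and a nonempty open set has two distinct points. This
    makes [1 / (2 * M)] a genuine positive bound. *)
Lemma linearly_connected_constant_ge_1 (A : C -> Prop) (M : R) :
  is_domain A -> linearly_connected_with M A -> 1 <= M.
Proof.
intros [[w Hw] [HA _]] HM.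
destruct (open_not_singleton A w HA Hw) as [w' [Hw' Hne]].
destruct (HM w w' Hw Hw') as [gamma [[_ [_ [G0 G1]]] HL]].
assert (K := chain_path_length gamma _ _
  (chain_step gamma 0 0 1 0 (chain_refl gamma 0) Rle_0_1) HL).
rewrite G0, G1, (Cmod_minus_sym w') in K.
assert (0 < Cmod (w - w')); [|nra].
apply Cmod_gt_0; intros E; apply Hne.
replace w' with (w - (w - w'))%C by ring; rewrite E; ring.
Qed.

Lemma open_unit_disk : open unit_disk.
Proof.
intros z Hz; apply locally_Cmod; exists (1 - Cmod z); split; [unfold unit_disk in Hz; lra|].
intros w Hw; unfold unit_disk.
assert (T := Cmod_triangle (w - z) z).
replace (w - z + z)%C with w in T by ring; lra.
Qed.

(** * Perturbations of a univalent function *)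

(* [f] is a local diffeomorphism and the differential of [H o f^-1] is bounded
   by [k]. *)
Definition subordinate (k : R) (U : C -> Prop) (f H : C -> C) : Prop :=
  forall z, U z -> exists A B A' B' : C,
    Cmod A <> Cmod B /\ real_diff f z A B /\ real_diff H z A' B' /\
    Cmod A' + Cmod B' <= k * Rabs (Cmod A - Cmod B).

Lemma subordinate_local_diffeo (k : R) (U : C -> Prop) (f H : C -> C) (z : C) :
  subordinate k U f H -> U z ->
  exists A B : C, Cmod A <> Cmod B /\ real_diff f z A B.
Proof.
intros Hs Hz; destruct (Hs z Hz) as [A [B [_ [_ [H1 [H2 _]]]]]].
exists A, B; auto.
Qed.

(** The path is lifted through the inverse of [f]; along the lift the increments of [H] are locally
    controlled by those of [gamma], which is what the length arguments consume. *)
Lemma subordinate_lift (k : R) (U : C -> Prop) (f H : C -> C) (z1 z2 : C)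
  (gamma : R -> C) :
  open U -> univalent_on U f -> 0 <= k -> subordinate k U f H ->
  U z1 -> U z2 -> path_in (image f U) (f z1) (f z2) gamma ->
  exists zeta : R -> C, zeta 0 = z1 /\ zeta 1 = z2 /\
    (forall t, unit_interval t -> U (zeta t) /\ f (zeta t) = gamma t) /\
    forall eps, 0 < eps -> forall t, unit_interval t -> exists d, 0 < d /\
      forall s, unit_interval s -> Rabs (s - t) < d ->
        Cmod (H (zeta s) - H (zeta t)) <= (k + eps) * Cmod (gamma s - gamma t).
Proof.
intros HU Hinj Hk Hs Hz1 Hz2 [Hc [Hin [G0 G1]]].
(* On the unit interval this is the unique preimage of [gamma t]; elsewhere the value is
   arbitrary. *)
set (zeta := fun t => epsilon (inhabits z1) (fun z => U z /\ f z = gamma t)).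
assert (Hzeta : forall t, unit_interval t -> U (zeta t) /\ f (zeta t) = gamma t).
{ intros t Ht; apply (epsilon_spec (inhabits z1) (fun z => U z /\ f z = gamma t)).
  exact (Hin t Ht). }
assert (I0 : unit_interval 0) by (unfold unit_interval; lra).
assert (I1 : unit_interval 1) by (unfold unit_interval; lra).
destruct (Hzeta 0 I0) as [U0 F0]; destruct (Hzeta 1 I1) as [U1 F1].
exists zeta; split; [|split; [|split]]; trivial.
- apply Hinj; trivial; rewrite F0; trivial.
- apply Hinj; trivial; rewrite F1; trivial.
- intros eps Heps t Ht; destruct (Hzeta t Ht) as [Ut Ft].
  destruct (Hs _ Ut) as [A [B [A' [B' [H1 [H2 [H3 H4]]]]]]].
  destruct (inverse_composition_lipschitz U f H (zeta t) A B A' B' k eps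
    HU Ut Hinj (fun z => subordinate_local_diffeo k U f H z Hs) H1 H2 H3 Hk H4 Heps)
    as [e [He HL]].
  destruct (proj1 (path_continuous gamma) Hc t Ht e He) as [d [Hd H5]].
  exists d; split; trivial; intros s Is Hst.
  destruct (Hzeta s Is) as [Us Fs].
  rewrite <- Ft, <- Fs; apply HL; trivial; rewrite Ft, Fs; auto.
Qed.

(** The local bound is summed along a path of length at most [M * |f z1 - f z2|], and then [eps]
    tends to 0. *)
Lemma subordinate_lipschitz (k M : R) (U : C -> Prop) (f H : C -> C) (z1 z2 : C) :
  open U -> univalent_on U f -> 0 <= k -> subordinate k U f H ->
  linearly_connected_with M (image f U) -> U z1 -> U z2 ->
  Cmod (H z1 - H z2) <= k * M * Cmod (f z1 - f z2).
Proof.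
intros HU Hinj Hk Hs HM Hz1 Hz2.
destruct (HM (f z1) (f z2)) as [gamma [Hg HL]]; [exists z1; auto|exists z2; auto|].
destruct (subordinate_lift k U f H z1 z2 gamma HU Hinj Hk Hs Hz1 Hz2 Hg)
  as [zeta [Z0 [Z1 [_ Hloc]]]].
set (L := M * Cmod (f z1 - f z2)) in *.
assert (HE : forall eps, 0 < eps -> 0 <= L /\ Cmod (H z1 - H z2) <= (k + eps) * L).
{ intros eps Heps.
  destruct (chain_local_lipschitz gamma (fun t => H (zeta t)) (k + eps) 0 1 Rle_0_1
    (Hloc eps Heps)) as [l [Hl Hle]].
  rewrite Z0, Z1, Cmod_minus_sym in Hle.
  assert (Hl' := chain_path_length gamma l L Hl HL).
  assert (Hl0 := chain_path_length gamma _ _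
    (chain_step gamma 0 0 1 0 (chain_refl gamma 0) Rle_0_1) HL).
  split; [generalize (Cmod_ge_0 (gamma 1 - gamma 0)); lra|].
  apply Rle_trans with (1 := Hle), Rmult_le_compat_l; lra. }
destruct (HE 1 Rlt_0_1) as [HL0 _].
rewrite Rmult_assoc; fold L.
apply le_epsilon; intros e He.
(* The added 1 covers the case [L = 0]. *)
assert (He' : 0 < e / (1 + L)) by (apply Rdiv_lt_0_compat; lra).
destruct (HE _ He') as [_ K].
apply Rle_trans with (1 := K).
assert (e / (1 + L) * (1 + L) = e) by (field; lra).
lra.
Qed.

(** In the variable [w = f z], the map [F] is the identity plus a map with Lipschitz constant
    [|b| * k * M]. *)
Lemma perturbation_lower_bound (k M : R) (U : C -> Prop) (f H F : C -> C)
  (b z1 z2 : C) :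
  open U -> univalent_on U f -> 0 <= k -> subordinate k U f H ->
  linearly_connected_with M (image f U) ->
  (forall z, U z -> F z = f z + b * H z)%C -> U z1 -> U z2 ->
  (1 - Cmod b * k * M) * Cmod (f z1 - f z2) <= Cmod (F z1 - F z2).
Proof.
intros HU Hinj Hk Hs HM HF Hz1 Hz2.
assert (K := subordinate_lipschitz k M U f H z1 z2 HU Hinj Hk Hs HM Hz1 Hz2).
rewrite !HF by trivial.
replace (f z1 + b * H z1 - (f z2 + b * H z2))%C
  with ((f z1 - f z2) + b * (H z1 - H z2))%C by ring.
assert (T := Cmod_triangle_rev (f z1 - f z2) (b * (H z1 - H z2))).
rewrite Cmod_mult in T.
assert (K' := Rmult_le_compat_l _ _ _ (Cmod_ge_0 b) K).
lra.
Qed.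

Lemma perturbation_univalent (k M : R) (U : C -> Prop) (f H F : C -> C) (b : C) :
  open U -> univalent_on U f -> 0 <= k -> subordinate k U f H ->
  linearly_connected_with M (image f U) ->
  (forall z, U z -> F z = f z + b * H z)%C -> Cmod b * k * M < 1 ->
  univalent_on U F.
Proof.
intros HU Hinj Hk Hs HM HF Hb z1 z2 Hz1 Hz2 E.
assert (K := perturbation_lower_bound k M U f H F b z1 z2 HU Hinj Hk Hs HM HF Hz1 Hz2).
rewrite E in K; replace (F z2 - F z2)%C with (RtoC 0) in K by ring.
rewrite Cmod_0 in K.
apply Hinj; trivial.
assert (K0 : Cmod (f z1 - f z2) = 0) by (generalize (Cmod_ge_0 (f z1 - f z2)); nra).
apply Cmod_eq_0 in K0.
replace (f z1) with (f z1 - f z2 + f z2)%C by ring; rewrite K0; ring.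
Qed.

(** The Jacobian of [F] does not vanish: passing from [f] to [F] changes [|A| - |B|] by at most
    [|b| * (|A'| + |B'|)], less than its absolute value. *)
Lemma perturbation_open_image (k : R) (U : C -> Prop) (f H F : C -> C) (b : C) :
  open U -> subordinate k U f H ->
  (forall z, U z -> F z = f z + b * H z)%C -> Cmod b * k < 1 ->
  open (image F U).
Proof.
intros HU Hs HF Hb; apply real_diff_open_image; trivial.
intros z Hz; destruct (Hs z Hz) as [A [B [A' [B' [H1 [H2 [H3 H4]]]]]]].
exists (A + b * A')%C, (B + b * B')%C; split.
- intros E.
  assert (T1 := Cmod_triangle A (b * A')); assert (T2 := Cmod_triangle_rev A (b * A')).
  assert (T3 := Cmod_triangle B (b * B')); assert (T4 := Cmod_triangle_rev B (b * B')).
  rewrite !Cmod_mult in *.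
  assert (Hl : 0 < Rabs (Cmod A - Cmod B)) by (apply Rabs_pos_lt; lra).
  assert (K := Rmult_le_compat_l _ _ _ (Cmod_ge_0 b) H4).
  unfold Rabs in *; destruct (Rcase_abs (Cmod A - Cmod B)); nra.
- apply real_diff_ext_loc with (fun z => f z + b * H z)%C.
  + generalize (HU z Hz); apply filter_imp; intros w Hw; rewrite HF; trivial.
  + apply real_diff_plus; trivial; apply real_diff_scal; trivial.
Qed.

Lemma perturbation_path (k : R) (U : C -> Prop) (f H F : C -> C) (b z1 z2 : C)
  (gamma : R -> C) (L : R) :
  open U -> univalent_on U f -> 0 <= k -> subordinate k U f H ->
  (forall z, U z -> F z = f z + b * H z)%C -> U z1 -> U z2 ->
  path_in (image f U) (f z1) (f z2) gamma -> Rbar_le (path_length gamma) L ->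
  exists Gamma : R -> C, path_in (image F U) (F z1) (F z2) Gamma /\
    Rbar_le (path_length Gamma) ((1 + Cmod b * (k + 1)) * L).
Proof.
intros HU Hinj Hk Hs HF Hz1 Hz2 Hg HL.
destruct (subordinate_lift k U f H z1 z2 gamma HU Hinj Hk Hs Hz1 Hz2 Hg)
  as [zeta [Z0 [Z1 [Hzeta Hloc]]]].
(* A local Lipschitz constant of [w + b h w]; the 1 added to [k] is the choice [eps = 1] in the
   lift. *)
set (kappa := 1 + Cmod b * (k + 1)).
assert (Hkappa : 1 <= kappa) by (unfold kappa; generalize (Cmod_ge_0 b); nra).
assert (Hloc' : forall t, unit_interval t -> exists d, 0 < d /\
  forall s, unit_interval s -> Rabs (s - t) < d ->
    Cmod (F (zeta s) - F (zeta t)) <= kappa * Cmod (gamma s - gamma t)).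
{ intros t Ht; destruct (Hloc 1 Rlt_0_1 t Ht) as [d [Hd K]].
  exists d; split; trivial; intros s Is Hst; specialize (K s Is Hst).
  destruct (Hzeta t Ht) as [Ut Ft]; destruct (Hzeta s Is) as [Us Fs].
  rewrite (HF _ Ut), (HF _ Us), Ft, Fs.
  replace (gamma s + b * H (zeta s) - (gamma t + b * H (zeta t)))%C
    with ((gamma s - gamma t) + b * (H (zeta s) - H (zeta t)))%C by ring.
  apply Rle_trans with (1 := Cmod_triangle _ _); rewrite Cmod_mult; unfold kappa.
  assert (K' := Rmult_le_compat_l _ _ _ (Cmod_ge_0 b) K); lra. }
exists (fun t => F (zeta t)); split; [split; [|split; [|split]]|].
- apply path_continuous; intros t Ht eps Heps.
  destruct Hg as [Hc _].
  assert (Heps' : 0 < eps / kappa) by (apply Rdiv_lt_0_compat; lra).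
  destruct (proj1 (path_continuous gamma) Hc t Ht _ Heps') as [d1 [Hd1 K1]].
  destruct (Hloc' t Ht) as [d2 [Hd2 K2]].
  exists (Rmin d1 d2); split; [apply Rmin_pos; trivial|].
  intros s Is Hst.
  apply Rle_lt_trans with (kappa * Cmod (gamma s - gamma t)).
  + apply K2; trivial; apply Rlt_le_trans with (1 := Hst), Rmin_r.
  + replace eps with (kappa * (eps / kappa)) by (field; lra).
    apply Rmult_lt_compat_l; [lra|].
    apply K1; trivial; apply Rlt_le_trans with (1 := Hst), Rmin_l.
- intros t Ht; exists (zeta t); split; trivial; apply Hzeta; trivial.
- rewrite Z0; trivial.
- rewrite Z1; trivial.
- apply path_length_local_lipschitz with gamma; trivial; lra.
Qed.

Lemma perturbation_linearly_connected (k M : R) (U : C -> Prop) (f H F : C -> C)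
  (b : C) :
  open U -> univalent_on U f -> 0 <= k -> subordinate k U f H ->
  0 <= M -> linearly_connected_with M (image f U) ->
  (forall z, U z -> F z = f z + b * H z)%C -> Cmod b * k * M < 1 ->
  linearly_connected (image F U).
Proof.
intros HU Hinj Hk Hs HM0 HM HF Hb.
set (kappa := 1 + Cmod b * (k + 1)).
assert (Hkappa : 1 <= kappa) by (unfold kappa; generalize (Cmod_ge_0 b); nra).
(* Lengths grow by at most [kappa], while distances shrink by at most the factor in the
   denominator. *)
exists (kappa * M / (1 - Cmod b * k * M)).
intros w1 w2 [z1 [Hz1 <-]] [z2 [Hz2 <-]].
destruct (HM (f z1) (f z2)) as [gamma [Hg HL]]; [exists z1; auto|exists z2; auto|].
destruct (perturbation_path k U f H F b z1 z2 gamma _ HU Hinj Hk Hs HF Hz1 Hz2 Hg HL)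
  as [Gamma [HG HGL]].
exists Gamma; split; trivial.
apply Rbar_le_trans with (1 := HGL); fold kappa; simpl.
assert (K := perturbation_lower_bound k M U f H F b z1 z2 HU Hinj Hk Hs HM HF Hz1 Hz2).
set (q := 1 - Cmod b * k * M) in *.
assert (Hq : 0 < q) by (unfold q; lra).
replace (kappa * (M * Cmod (f z1 - f z2)))
  with (kappa * M / q * (q * Cmod (f z1 - f z2))) by (field; lra).
apply Rmult_le_compat_l; trivial.
apply Rmult_le_pos; [apply Rmult_le_pos; lra|apply Rlt_le, Rinv_0_lt_compat; trivial].
Qed.

Lemma linearly_connected_connected (A : C -> Prop) :
  linearly_connected A -> connected_set A.
Proof.
intros [M HM]; apply path_connected_connected; intros w1 w2 H1 H2.
destruct (HM w1 w2 H1 H2) as [gamma [Hg _]]; exists gamma; trivial.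
Qed.

(** * Application to the family [f_family] *)

Lemma f_family_subordinate (p : nat) (G K f : C -> C) (k : R) :
  C1_on unit_disk G -> C1_on unit_disk K ->
  (forall z, unit_disk z ->
    f z = (RtoC (Cmod z ^ (2 * (p - 1)))%R * G z + K z)%C) ->
  (forall z, unit_disk z -> lambda f z <> 0) ->
  (forall z, unit_disk z ->
    (INR (2 * (p - 1)) * Cmod (G z) + Lambda G z) / Rabs (lambda f z) <= k) ->
  subordinate k unit_disk f (fun z => RtoC (Cmod z ^ (2 * (p - 1))) * G z)%C.
Proof.
intros HG HK Hf Hlam Hk z Hz.
assert (Hz1 : Cmod z <= 1) by (unfold unit_disk in Hz; lra).
set (m := (p - 1)%nat) in *.
destruct (real_diff_Cmod_pow m z Hz1) as [A [B [HA [HB HN]]]].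
assert (DG := C1_on_real_diff _ _ z open_unit_disk Hz HG).
assert (DK := C1_on_real_diff _ _ z open_unit_disk Hz HK).
assert (DH := real_diff_mult _ _ _ _ _ _ _ HN DG).
assert (Df := real_diff_plus _ _ _ _ _ _ _ DH DK).
apply real_diff_ext_loc with (g2 := f) in Df.
2: { generalize (open_unit_disk z Hz); apply filter_imp; intros w Hw; rewrite Hf; trivial. }
assert (W := real_diff_Wirtinger _ _ _ _ Df); destruct W as [W1 W2].
rewrite <- W1, <- W2 in Df.
specialize (Hlam z Hz); specialize (Hk z Hz).
match type of DH with real_diff _ _ ?X ?Y =>
  exists (Dz f z), (Dzbar f z), X, Y end.
split; [unfold lambda in Hlam; lra|].
split; [trivial|split; [trivial|]].
change (Cmod (Dz f z) - Cmod (Dzbar f z)) with (lambda f z).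
assert (Hl : 0 < Rabs (lambda f z)) by (apply Rabs_pos_lt; trivial).
assert (HN1 := Cmod_RtoC_pow_le_1 (2 * m) _ Hz1).
(* The two derivatives of the power contribute [m * |G|] each, and the power itself, being at most 1
   on the disk, leaves at most [Lambda G]. *)
apply Rle_trans with (INR (2 * m) * Cmod (G z) + Lambda G z).
- assert (T1 := Cmod_triangle (A * G z) (RtoC (Cmod z ^ (2 * m)) * Dz G z)).
  assert (T2 := Cmod_triangle (B * G z) (RtoC (Cmod z ^ (2 * m)) * Dzbar G z)).
  rewrite !Cmod_mult in T1, T2.
  rewrite mult_INR; replace (INR 2) with 2 by (simpl; ring); unfold Lambda.
  generalize (Cmod_ge_0 (G z)) (Cmod_ge_0 (Dz G z)) (Cmod_ge_0 (Dzbar G z)); intros.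
  assert (Cmod A * Cmod (G z) <= INR m * Cmod (G z)) by (apply Rmult_le_compat_r; lra).
  assert (Cmod B * Cmod (G z) <= INR m * Cmod (G z)) by (apply Rmult_le_compat_r; lra).
  nra.
- apply Rle_div_l; trivial.
Qed.

Theorem theorem6 (p : nat) (G K f : C -> C) (M : R)
  (hp : (1 <= p)%nat)
  (hG : C1_on unit_disk G)
  (hK : harmonic_on unit_disk K)
  (hf : forall z : C, unit_disk z ->
    f z = (RtoC (Cmod z ^ (2 * (p - 1)))%R * G z + K z)%C)
  (hf_univalent : univalent_on unit_disk f)
  (hf_domain : is_domain (image f unit_disk))
  (hf_linconn : linearly_connected_with M (image f unit_disk))
  (hlambda : forall z : C, unit_disk z -> lambda f z <> 0%R) :
  ((forall z : C, unit_disk z ->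
      ((INR (2 * (p - 1)) * Cmod (G z) + Lambda G z) / Rabs (lambda f z)
        < 1 / (2 * M))%R) ->
    forall a : C, (Cmod a < 1)%R -> univalent_on unit_disk (f_family p G K a))
  /\
  ((exists c : R, (c < 1 / (2 * M))%R /\
      forall z : C, unit_disk z ->
        ((INR (2 * (p - 1)) * Cmod (G z) + Lambda G z) / Rabs (lambda f z)
          <= c)%R) ->
    forall a : C, (Cmod a < 1)%R ->
      is_domain (image (f_family p G K a) unit_disk) /\
      linearly_connected (image (f_family p G K a) unit_disk)).
Proof.
assert (HM := linearly_connected_constant_ge_1 _ M hf_domain hf_linconn).
set (H := fun z => (RtoC (Cmod z ^ (2 * (p - 1))) * G z)%C).
assert (Hk : 0 <= 1 / (2 * M)) by (apply Rlt_le, Rdiv_lt_0_compat; lra).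
assert (Hsub : (forall z, unit_disk z ->
  (INR (2 * (p - 1)) * Cmod (G z) + Lambda G z) / Rabs (lambda f z)
    <= 1 / (2 * M)) -> subordinate (1 / (2 * M)) unit_disk f H).
{ apply f_family_subordinate with K; trivial; apply hK. }
assert (HF : forall a z, unit_disk z ->
  f_family p G K a z = (f z + (a - 1) * H z)%C).
{ intros a z Hz; rewrite hf by trivial; unfold f_family, H; ring. }
assert (Hb : forall a : C, Cmod a < 1 -> Cmod (a - 1) < 2).
{ intros a Ha; apply Rle_lt_trans with (1 := Cmod_minus_triangle _ _).
  rewrite Cmod_1; lra. }
(* Strictness comes from [|a - 1| < 2], so the non-strict bound [1 / (2 * M)] can serve as [k]. *)
assert (HbM : forall a : C, Cmod a < 1 -> Cmod (a - 1) * (1 / (2 * M)) * M < 1).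
{ intros a Ha; specialize (Hb a Ha).
  replace (Cmod (a - 1) * (1 / (2 * M)) * M) with (Cmod (a - 1) / 2) by (field; lra).
  lra. }
split.
- intros Hlt a Ha.
  apply (perturbation_univalent (1 / (2 * M)) M unit_disk f H _ (a - 1));
    auto using open_unit_disk.
  apply Hsub; intros z Hz; apply Rlt_le; auto.
- intros [c [Hc Hle]] a Ha.
  assert (Hs : subordinate (1 / (2 * M)) unit_disk f H).
  { apply Hsub; intros z Hz; specialize (Hle z Hz); lra. }
  assert (HL : linearly_connected (image (f_family p G K a) unit_disk)).
  { apply (perturbation_linearly_connected (1 / (2 * M)) M unit_disk f H _ (a - 1));
      auto using open_unit_disk; lra. }
  split; trivial; split; [|split].
  + exists (f_family p G K a 0), 0; split; trivial.
    unfold unit_disk; rewrite Cmod_0; lra.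
  + apply (perturbation_open_image (1 / (2 * M)) unit_disk f H _ (a - 1));
      auto using open_unit_disk.
    (* Since [M >= 1], the bound on [|b| * k * M] also bounds [|b| * k]. *)
    specialize (HbM a Ha).
    assert (0 <= Cmod (a - 1) * (1 / (2 * M)))
      by (apply Rmult_le_pos; [apply Cmod_ge_0|trivial]).
    nra.
  + apply linearly_connected_connected; trivial.
Qed.
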